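(* Let $n\ge3$ and consider the complete graph on $n$ nodes (every pair of distinct nodes joined by an edge), with an arbitrary starting node. Then $$\mathbb E_{\pi_{neg}}[T_C]<\mathbb E_{\pi_{rw}}[T_C].$$
   Context: $T_C$ is the smallest $m$ such that $X_0,\dots,X_m$ visit all nodes of the graph. Random walk $\pi_{rw}$: if $X_m=i$, $X_{m+1}$ is a uniformly random neighbour of $i$, independently of the past. Negative feedback $\pi_{neg}$: for an edge from $i$ to $j$, let $N_{ij}^{(m)}$ be the number of times $t<m$ with $X_t=i,X_{t+1}=j$. Let $Smin_i^{(m)}$ be the set of neighbours $j$ of $i$ minimizing $N_{ij}^{(m)}$. If $X_m=i$, then given the past, $X_{m+1}$ is uniformly distributed on $Smin_i^{(m)}$. *)

(* Defs.v *)
From HB Require Import structures.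
From mathcomp Require Import all_boot all_order all_algebra.
From mathcomp Require Import all_classical all_reals all_analysis.

Set Implicit Arguments.
Unset Strict Implicit.
Unset Printing Implicit Defensive.

Import Order.TTheory GRing.Theory Num.Theory.
Import numFieldNormedType.Exports.

Local Open Scope classical_set_scope.
Local Open Scope ring_scope.

Definition complete_graph (n : nat) : rel 'I_n := fun i j => i != j.

(* A graph is given by its adjacency relation e on a finite type V, a
   trajectory by a function x : nat -> V. *)
Section Trajectories.
Variables (V : finType) (e : rel V).
Implicit Types (x : nat -> V) (m : nat) (i j : V).

Definition neighbours i : {set V} := [set j | e i j]%SET.

Definition covered x m : bool := [forall v, exists t : 'I_m.+1, x t == v].

(* The cover time is +oo when some node is never visited. *)
Definition cover_time (R : realType) x : \bar R :=
  match pselect (exists m, covered x m) with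
  | left ex_m => ((ex_minn ex_m)%:R)%:E
  | right _ => +oo%E
  end.

Definition traversals x m i j : nat :=
  #|[set t : 'I_m | (x t == i) && (x t.+1 == j)]%SET|.

Definition Smin x m i : {set V} :=
  [set j in neighbours i |
    [forall k in neighbours i, traversals x m i j <= traversals x m i k]%N]%SET.

(* A walk rule maps (x, m) to the set from which the node at time m.+1 is
   drawn uniformly; both rules below only read x 0, ..., x m. *)
Definition random_rule x m : {set V} := neighbours (x m).

Definition negative_feedback_rule x m : {set V} := Smin x m (x m).

End Trajectories.

Section Walks.
Context {d : measure_display} {T : measurableType d} {R : realType}.
Variable P : probability T R.

Definition cond_prob (A B : set T) : R := fine (P (A `&` B)) / fine (P B).

Definition uniform_on (V : finType) (S : {set V}) (j : V) : R :=
  (j \in S)%:R / #|S|%:R.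

Definition history (V : finType) (X : nat -> T -> V) (x : nat -> V) (m : nat) :
  set T := [set w | forall t, (t <= m)%N -> X t w = x t].

(* V carries the discrete sigma-algebra, so that measurability of X m amounts
   to measurability of its fibres. *)
Record walk_from (V : finType) (rule : (nat -> V) -> nat -> {set V}) (i0 : V)
    (X : nat -> T -> V) : Prop := WalkFrom {
  walk_measurable : forall m v, measurable (X m @^-1` [set v]);
  walk_start : P (X 0%N @^-1` [set i0]) = 1%E;
  walk_step : forall m x j, (0 < P (history X x m))%E ->
    cond_prob (X m.+1 @^-1` [set j]) (history X x m) = uniform_on (rule x m) j
}.

Definition expected_cover_time (V : finType) (X : nat -> T -> V) : \bar R :=
  (\int[P]_w cover_time R (fun m => X m w))%E.

End Walks.

(* Main.v *)
(** Let h(l) = (n-1)(1 + 1/2 + ... + 1/l), the potential of a walk with l nodes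
    still missing.  Under either rule the next node is uniform on a set S of
    neighbours containing all the missing nodes, so before the cover time the
    potential drops on average by (n-1)/#|S| in one step.  For the random walk
    #|S| = n-1, the drop is exactly 1, the potential tends to 0 geometrically
    and the expected cover time is h(n-1).  For negative feedback #|S| <= n-1,
    so the drop is at least 1, and it exceeds 1 after the path i0, j, i0, which
    has positive probability: the expected cover time is smaller by a positive
    constant. *)

Require Import Defs.
From mathcomp Require Import all_boot all_order all_algebra.
From mathcomp Require Import all_classical all_reals all_analysis.
From mathcomp Require Import ring measurable_realfun.

Set Implicit Arguments.
Unset Strict Implicit.
Unset Printing Implicit Defensive.

Import Order.TTheory GRing.Theory Num.Theory.

Local Open Scope ring_scope.

(** * Paths and the nodes they have visited *)

Definition extend (V : Type) (x : nat -> V) m (j : V) : nat -> V :=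
  fun t => if (t <= m)%N then x t else j.

Section Visited.
Variable V : finType.
Implicit Types (x : nat -> V) (m : nat) (v j : V).

Definition visited x m : {set V} :=
  [set v | [exists t : 'I_m.+1, x t == v]]%SET.

Lemma visitedP x m v :
  reflect (exists2 t, (t <= m)%N & x t = v) (v \in visited x m).
Proof.
rewrite inE; apply: (iffP existsP) => [[t /eqP xt]|[t tm xt]].
  by exists t => //; rewrite -ltnS.
by exists (Ordinal (n:=m.+1) (m:=t) tm); apply/eqP.
Qed.

Lemma covered_visited x m : covered x m = (#|~: visited x m|%SET == 0)%N.
Proof.
rewrite cards_eq0; apply/forallP/eqP => [cov|vis0 v].
  by apply/setP => v; rewrite !inE cov.
by apply: contraT => nv; have := finset.in_set0 v; rewrite -vis0 !inE nv.
Qed.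

Lemma covered_mono x m m' : (m <= m')%N -> covered x m -> covered x m'.
Proof.
move=> mm' /forallP cov; apply/forallP => v.
have /existsP[t /eqP xt] := cov v.
apply/existsP; exists (widen_ord (n:=m.+1) (m:=m'.+1) mm' t); exact/eqP.
Qed.

Lemma eq_covered x y m : (forall t, (t <= m)%N -> x t = y t) ->
  covered x m = covered y m.
Proof.
move=> xy; apply: eq_forallb => v; apply: eq_existsb => t.
by rewrite xy// -ltnS.
Qed.

Lemma visited_extend x m j :
  visited (extend x m j) m.+1 = (j |: visited x m)%SET.
Proof.
apply/setP => v; rewrite in_setU1; apply/visitedP/orP => [[t]|[/eqP ->|]].
- rewrite leq_eqVlt => /orP[/eqP ->|tm]; rewrite /extend.
    by rewrite ltnn; left; apply/eqP.
  by rewrite -ltnS tm => <-; right; apply/visitedP; exists t.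
- by exists m.+1; rewrite // /extend ltnn.
- by case/visitedP => t tm <-; exists t; rewrite /extend ?tm// ltnW.
Qed.

Lemma visited_last x m : x m \in visited x m.
Proof. by apply/visitedP; exists m. Qed.

End Visited.

(** * The harmonic potential and uniform averages *)

Section Potential.
Variables (R : realType) (V : finType).
Implicit Types (A S : {set V}) (x : nat -> V) (k l m : nat) (j : V).

(* The expected time the random walk needs to cover a complete graph once the
   nodes of A are visited: #|V|.-1 / l is the mean time of the next discovery
   when l nodes are missing. *)
Definition potential A : R := \sum_(l < #|~: A|%SET) #|V|.-1%:R / l.+1%:R.

Lemma potential_ge0 A : 0 <= potential A.
Proof. by apply: sumr_ge0 => l _; rewrite divr_ge0. Qed.

Lemma potential_le A : potential A <= potential finset.set0.
Proof.
rewrite /potential -!(big_mkord xpredT (fun l => #|V|.-1%:R / l.+1%:R)).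
have le : (#|~: A|%SET <= #|~: finset.set0 : {set V}|%SET)%N.
  by apply: subset_leq_card; rewrite finset.setCS finset.sub0set.
rewrite [leRHS](big_cat_nat _ le)//= lerDl.
by apply: sumr_ge0 => l _; rewrite divr_ge0.
Qed.

Lemma potential_eq0 A : #|~: A|%SET = 0%N -> potential A = 0.
Proof. by rewrite /potential => ->; rewrite big_ord0. Qed.

(** A newly visited node removes exactly the last term of the harmonic sum. *)
Lemma potential_setU1 A j : potential (j |: A)%SET =
  potential A - (j \notin A)%:R * (#|V|.-1%:R / #|~: A|%SET%:R).
Proof.
have [jA|jA] /= := boolP (j \in A).
  by rewrite mul0r subr0 (finset.setUidPr _) ?finset.sub1set.
rewrite mul1r /potential.
have -> : #|~: A|%SET = #|~: (j |: A)|%SET.+1.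
  by rewrite (cardsD1 j) inE jA add1n finset.setCU finset.setDE finset.setIC.
by rewrite big_ord_recr/= addrK.
Qed.

Definition average S (f : V -> R) : R := \sum_j @uniform_on R _ S j * f j.

Lemma uniform_on_ge0 S j : 0 <= @uniform_on R _ S j.
Proof. by rewrite divr_ge0. Qed.

Lemma uniform_on_gt0 S j : j \in S -> 0 < @uniform_on R _ S j.
Proof.
move=> jS; rewrite /uniform_on jS divr_gt0// ltr0n card_gt0.
by apply/finset.set0Pn; exists j.
Qed.

Lemma ler_average S f g : (forall j, f j <= g j) -> average S f <= average S g.
Proof.
by move=> fg; apply: ler_sum => j _; rewrite ler_wpM2l ?uniform_on_ge0.
Qed.

Lemma averageB S f g :
  average S (fun j => f j - g j) = average S f - average S g.
Proof. by rewrite /average -sumrB; apply: eq_bigr => j _; rewrite mulrBr. Qed.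

Lemma averageZ S a f : average S (fun j => a * f j) = a * average S f.
Proof.
by rewrite /average mulr_sumr; apply: eq_bigr => j _; rewrite mulrCA.
Qed.

Lemma average_ge S f j : (forall i, 0 <= f i) ->
  @uniform_on R _ S j * f j <= average S f.
Proof.
move=> f0; rewrite /average (bigD1 j)//= lerDl sumr_ge0// => i _.
by rewrite mulr_ge0 ?uniform_on_ge0.
Qed.

Lemma average_cst S a : S != finset.set0 -> average S (fun=> a) = a.
Proof.
move=> S0; rewrite /average -mulr_suml /uniform_on -mulr_suml -natr_sum.
rewrite (eq_bigr (fun j => if j \in S then 1 else 0)%N); last first.
  by move=> j _; case: ifP.
rewrite -big_mkcond/= sum1_card divff ?mul1r//.
by rewrite pnatr_eq0 cards_eq0.
Qed.

(** As [S] contains all missing nodes, a uniform point of [S] is new with probability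
    [#|~: A| / #|S|]. A discovery lowers the potential by [#|V|.-1 / #|~: A|], so the number of
    missing nodes cancels. *)
Lemma average_potential A S : (~: A \subset S)%SET -> (0 < #|~: A|%SET)%N ->
  average S (fun j => potential (j |: A)%SET) =
  potential A - #|V|.-1%:R / #|S|%:R.
Proof.
move=> AS A0.
have S0 : (0 < #|S|)%N by apply: leq_trans A0 (subset_leq_card AS).
under [X in average S X]boolp.funext do rewrite potential_setU1.
rewrite averageB average_cst -?card_gt0//; congr (_ - _).
rewrite /average (eq_bigr _ (fun j _ => mulrA _ _ _)) -mulr_suml.
have -> : \sum_j @uniform_on R _ S j * (j \notin A)%:R =
    #|~: A|%SET%:R / #|S|%:R.
  rewrite /uniform_on.
  under eq_bigr do rewrite mulrAC -natrM mulnb.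
  rewrite -mulr_suml -natr_sum.
  congr (_%:R / _); rewrite -sum1_card [in RHS]big_mkcond.
  apply: eq_bigr => j _; have := fintype.subsetP AS j; rewrite !inE.
  by case: (j \in A) => /=; rewrite ?andbF// andbT => ->.
by field; rewrite !pnatr_eq0 -!lt0n S0 A0.
Qed.

End Potential.

(** * Conditional recursion and drift of the potential *)

Section Recursion.
Variables (R : realType) (V : finType) (rule : (nat -> V) -> nat -> {set V}).
Implicit Types (x : nat -> V) (k l m : nat) (j : V).

(* uncovered_prob k m x is the conditional probability that the graph is not
   covered at time m + k, given that the walk starts with x 0, ..., x m. *)
Fixpoint uncovered_prob k m x : R :=
  if k is k'.+1 then
    average (rule x m) (fun j => uncovered_prob k' m.+1 (extend x m j))
  else (~~ covered x m)%:R.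

Definition uncovered_sum k m x : R := \sum_(l < k) uncovered_prob l m x.

Definition gap k m x : R := potential R (visited x m) - uncovered_sum k m x.

Lemma gap0 m x : gap 0 m x = potential R (visited x m).
Proof. by rewrite /gap /uncovered_sum big_ord0 subr0. Qed.

Definition drift m x : R := potential R (visited x m) -
  average (rule x m) (fun j => potential R (j |: visited x m)%SET) -
  (~~ covered x m)%:R.

(** Conditioning on the next node. Iterated, this makes the gap the sum of the expected drifts plus
    the expected potential left after [k] steps. *)
Lemma gapS k m x : gap k.+1 m x =
  drift m x + average (rule x m) (fun j => gap k m.+1 (extend x m j)).
Proof.
rewrite /gap averageB /drift /uncovered_sum big_ord_recl /=.
have -> : \sum_(i < k) average (rule x m)
    (fun j => uncovered_prob i m.+1 (extend x m j)) =
    average (rule x m)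
     (fun j => \sum_(l < k) uncovered_prob l m.+1 (extend x m j)).
  by rewrite /average exchange_big; apply: eq_bigr => j _; rewrite mulr_sumr.
under [X in _ = _ + (average _ X - _)]boolp.funext do rewrite visited_extend.
by ring.
Qed.

Lemma drift_covered m x : covered x m -> drift m x = 0.
Proof.
move=> cov; have A0 : #|~: visited x m|%SET = 0%N.
  by apply/eqP; rewrite -covered_visited.
rewrite /drift cov subr0 potential_eq0// /average big1 ?subrr// => j _.
by rewrite potential_setU1 potential_eq0// A0 invr0 !mulr0 subr0 mulr0.
Qed.

Lemma drift_uncovered m x :
  ~~ covered x m -> (~: visited x m \subset rule x m)%SET ->
  drift m x = #|V|.-1%:R / #|rule x m|%:R - 1.
Proof.
move=> cov sub; rewrite /drift cov average_potential//.
  by rewrite subKr.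
by rewrite lt0n -covered_visited.
Qed.

Lemma gap_ge0 : (forall m x, 0 <= drift m x) -> forall k m x, 0 <= gap k m x.
Proof.
move=> drift0; elim=> [|k IH] m x; first by rewrite gap0 potential_ge0.
rewrite gapS addr_ge0// /average sumr_ge0// => j _.
by rewrite mulr_ge0 ?uniform_on_ge0.
Qed.

Lemma gap_ge_drift k m x :
  (forall m x, 0 <= drift m x) -> drift m x <= gap k.+1 m x.
Proof.
move=> drift0; rewrite gapS lerDl /average sumr_ge0// => j _.
by rewrite mulr_ge0 ?uniform_on_ge0 ?gap_ge0.
Qed.

(** Keeping a single successor in the average carries a lower bound on the gap backwards along a
    path of positive probability. *)
Lemma gap_ge_next k m x j : (forall m x, 0 <= drift m x) ->
  @uniform_on R _ (rule x m) j * gap k m.+1 (extend x m j) <= gap k.+1 m x.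
Proof.
move=> drift0; rewrite gapS ler_wpDl//.
apply: (@average_ge _ _ _ (fun j => gap k m.+1 (extend x m j))) => i.
by rewrite gap_ge0.
Qed.

(* When the drift vanishes the potential decreases on average by 1 before the
   cover time, hence by a factor 1 - 1 / potential set0 at least. *)
Lemma gap_geometric : 1 <= potential R (finset.set0 : {set V}) ->
  (forall m x, drift m x = 0) -> forall k m x,
  gap k m x <= (1 - (potential R (finset.set0 : {set V}))^-1) ^+ k *
               potential R (visited x m).
Proof.
set M := potential R _ => M1 drift0.
have M0 : 0 < M by apply: lt_le_trans M1.
elim=> [|k IH] m x; first by rewrite gap0 mul1r.
rewrite gapS drift0 add0r.
apply: le_trans (ler_average _ (fun j => IH m.+1 (extend x m j))) _.
rewrite averageZ exprSr -mulrA ler_wpM2l//.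
  by rewrite exprn_ge0// subr_ge0 invf_le1.
under [X in average _ X]boolp.funext do rewrite visited_extend.
have /eqP := drift0 m x.
rewrite /drift subr_eq0 subr_eq addrC -subr_eq => /eqP <-.
(* What remains is that the potential is at most [M] while uncovered, and 0 once covered. *)
rewrite mulrBl mul1r lerB// ler_pdivrMl//.
case cov : (covered x m) => /=; last by rewrite mulr1 potential_le.
by rewrite potential_eq0 ?mulr0//; apply/eqP; rewrite -covered_visited.
Qed.

End Recursion.

(** * The two rules on the complete graph *)

Section CompleteGraph.
Variables (R : realType) (n : nat).
Hypothesis n_ge3 : (3 <= n)%N.
Implicit Types (x : nat -> 'I_n) (k m t : nat) (i j v : 'I_n).

Local Notation e := (@complete_graph n).
Local Notation rw := (random_rule e).
Local Notation neg := (negative_feedback_rule e).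

Lemma neighbours_complete i : neighbours e i = [set~ i]%SET.
Proof. by apply/setP => j; rewrite !inE /complete_graph eq_sym. Qed.

Lemma traversals_eq0 x m i j :
  (forall t, (t < m)%N -> x t = i -> x t.+1 <> j) -> traversals x m i j = 0%N.
Proof.
move=> nij; apply/eqP; rewrite cards_eq0; apply/eqP/setP => t; rewrite !inE.
by apply/negbTE/andP => -[/eqP xi /eqP xj]; exact: (nij t).
Qed.

Lemma traversals_gt0 x m t : (t < m)%N -> (0 < traversals x m (x t) (x t.+1))%N.
Proof.
move=> tm; rewrite card_gt0; apply/finset.set0Pn.
by exists (Ordinal tm); rewrite inE !eqxx.
Qed.

Lemma Smin_untraversed x m i j :
  i != j -> traversals x m i j = 0%N -> j \in Smin e x m i.
Proof.
move=> ij N0; rewrite 2!inE N0; apply/andP; split => //.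
by apply/forall_inP.
Qed.

(** An edge into an unvisited node has never been traversed, and 0 is the least possible count. *)
Lemma unvisited_Smin x m : (~: visited x m \subset neg x m)%SET.
Proof.
apply/fintype.subsetP => v; rewrite inE => /visitedP nv.
apply: Smin_untraversed.
  by apply/eqP => xv; apply: nv; exists m.
by apply: traversals_eq0 => t tm _ xv; apply: nv; exists t.+1.
Qed.

Lemma random_drift m x : drift R rw m x = 0.
Proof.
have [cov|ncov] := boolP (covered x m); first exact: drift_covered.
rewrite drift_uncovered//; last first.
  rewrite /random_rule neighbours_complete finset.setCS finset.sub1set.
  exact: visited_last.
rewrite /random_rule neighbours_complete cardsC1 divff ?subrr//.
by rewrite pnatr_eq0 card_ord; case: n n_ge3 => [|[]].
Qed.

Lemma Smin_subset x m : (neg x m \subset [set~ x m])%SET.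
Proof.
rewrite -neighbours_complete; apply/fintype.subsetP => j.
by rewrite inE => /andP[].
Qed.

Lemma negative_feedback_drift m x : 0 <= drift R neg m x.
Proof.
have [cov|ncov] := boolP (covered x m); first by rewrite drift_covered.
rewrite drift_uncovered ?unvisited_Smin// subr_ge0.
have S0 : (0 < #|neg x m|)%N.
  apply: leq_trans (subset_leq_card (unvisited_Smin x m)).
  by rewrite lt0n -covered_visited.
rewrite ler_pdivlMr ?ltr0n// mul1r ler_nat -(cardsC1 (x m)).
exact: subset_leq_card (Smin_subset x m).
Qed.

(* After the path i0, j, i0 negative feedback avoids the visited node j, so that
   the drift is positive there. *)
Lemma negative_feedback_gap i0 :
  exists2 c : R, 0 < c & forall k, c <= gap R neg k.+3 0 (fun=> i0).
Proof.
have [j ji0] : exists j, j != i0.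
  have /finset.set0Pn[j] : [set~ i0]%SET != finset.set0.
    by rewrite -card_gt0 cardsC1 card_ord; case: n n_ge3 => [|[]].
  by rewrite !inE; exists j.
set x0 := (fun=> i0) : nat -> 'I_n.
set x1 := extend x0 0 j; set x2 := extend x1 1 i0.
(* The path repeats no directed edge, so each of its two steps follows an edge of count 0 and has
   positive weight. *)
have u0 : 0 < @uniform_on R _ (neg x0 0) j.
  have jS : j \in neg x0 0.
    by apply: Smin_untraversed; rewrite 1?eq_sym//; exact: traversals_eq0.
  exact: uniform_on_gt0.
have u1 : 0 < @uniform_on R _ (neg x1 1) i0.
  have i0S : i0 \in neg x1 1.
    apply: Smin_untraversed => //; apply: traversals_eq0 => -[|//] _ /=.
    by rewrite /x1 /extend /x0 /= => i0j; move: ji0; rewrite i0j eqxx.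
  exact: uniform_on_gt0.
have vis2 : visited x2 2 \subset [set i0; j]%SET.
  apply/fintype.subsetP => v /visitedP[[|[|[|//]]] _ <-];
    by rewrite !inE /x2 /x1 /extend /x0 /= eqxx ?orbT.
(* Two visited nodes leave a third one missing, as [n] is at least 3. *)
have ncov : (0 < #|~: visited x2 2|%SET)%N.
  rewrite cardsCs finset.setCK subn_gt0 card_ord.
  by rewrite (leq_ltn_trans (subset_leq_card vis2))// cards2 eq_sym ji0.
have d2 : 0 < drift R neg 2 x2.
  rewrite drift_uncovered ?unvisited_Smin ?covered_visited -?lt0n// subr_gt0.
  have S0 : (0 < #|neg x2 2|)%N.
    exact: leq_trans ncov (subset_leq_card (unvisited_Smin x2 2)).
  rewrite ltr_pdivlMr ?ltr0n// mul1r ltr_nat -(cardsC1 (x2 2)).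
  apply: fintype.proper_card; apply/fintype.properP.
  split; first exact: Smin_subset.
  exists j; first by rewrite !inE.
  have [v] : exists v, v \in ~: visited x2 2.
    by apply/finset.set0Pn; rewrite -card_gt0.
  rewrite inE => /visitedP nv.
  rewrite !inE; apply/negP => /andP[_ /forall_inP] /(_ v); rewrite inE.
  have -> : traversals x2 2 (x2 2) v = 0%N.
    by apply: traversals_eq0 => t tm _ xv; apply: nv; exists t.+1.
  (* The edge from [i0] to [j] was used at time 0, the edge to the missing [v] never, so [j] is not
     a minimizer. *)
  rewrite leqNgt (@traversals_gt0 x2 2 0)//= => /(_ _)/notF; apply.
  have nx : x2 2%N != v by apply/eqP => xv; apply: nv; exists 2%N.
  exact: nx.
(* The weights of the two steps times the drift they lead to; [k.+3] leaves room for both steps and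
   this drift. *)
exists (uniform_on (neg x0 0) j *
        (uniform_on (neg x1 1) i0 * drift R neg 2 x2)).
  by apply: mulr_gt0 => //; apply: mulr_gt0.
move=> k; apply: le_trans (gap_ge_next _ _ _ j negative_feedback_drift).
rewrite ler_pM2l//.
apply: le_trans (gap_ge_next _ _ _ i0 negative_feedback_drift).
by rewrite ler_pM2l//; apply: gap_ge_drift negative_feedback_drift.
Qed.

Lemma random_gap i0 (c : R) : 0 < c ->
  exists k, gap R rw k 0 (fun=> i0) < c.
Proof.
move=> c0; set M := potential R (finset.set0 : {set 'I_n}).
have M1 : 1 <= M.
  rewrite /M /potential finset.setC0 cardsT.
  have -> : #|'I_n| = #|'I_n|.-1.+1 by rewrite prednK// card_ord; case: n n_ge3.
  (* The term for one missing node is [n.-1], already at least 1. *)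
  rewrite big_ord_recl /= divr1 card_ord.
  apply: ler_wpDr; first by apply: sumr_ge0 => l _; rewrite divr_ge0.
  by rewrite ler1n; case: n n_ge3 => [|[]].
have M0 : 0 < M by apply: lt_le_trans M1.
have q1 : `|1 - M^-1| < 1.
  rewrite ger0_norm ?subr_ge0 ?invf_le1//.
  by rewrite ltrBlDr ltrDl invr_gt0.
(* The threshold [c / M] absorbs the factor [M] that bounds the initial potential in
   [gap_geometric]. *)
have /cvgrPdist_lt /(_ _ (divr_gt0 c0 M0))[k _ /(_ k (leqnn k))] := cvg_expr q1.
rewrite /= sub0r normrN ltr_pdivlMr// => qk; exists k.
apply: le_lt_trans qk; apply: le_trans (gap_geometric M1 random_drift _ _ _) _.
rewrite ler_pM ?potential_ge0 ?potential_le//; last exact: ler_norm.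
by rewrite exprn_ge0// subr_ge0 invf_le1.
Qed.

End CompleteGraph.

(** * The cover time as a sum of indicators *)

Lemma cover_time_nneseries (R : realType) (V : finType) (x : nat -> V) :
  cover_time R x = (\sum_(0 <= m <oo) ((~~ covered x m)%:R)%:E)%E.
Proof.
have ge0 m : (0 <= ((~~ covered x m)%:R : R)%:E)%E by rewrite lee_fin.
rewrite /cover_time; case: pselect => [ex|nex].
  case: ex_minnP => M covM minM.
  rewrite (nneseries_split 0 M) ?add0n//.
  (* A covered graph stays covered, so the terms from the cover time [M] on vanish. *)
  rewrite [X in (_ + X)%E]eseries0 => [|m Mm _]; last first.
    by rewrite (covered_mono Mm covM).
  rewrite adde0 sumEFin big_mkord (eq_bigr (fun=> 1)) => [|m _].
    by rewrite sumr_const card_ord.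
  by have [/minM|//] := boolP (covered x m); rewrite leqNgt ltn_ord.
apply/esym/eqyP => A A0.
(* If the graph is never covered all terms are 1, and this many of them exceed [A]. *)
apply: le_trans (nneseries_lim_ge (Num.truncn A).+1 _) => //.
rewrite sumEFin lee_fin (eq_bigr (fun=> 1)) => [|m _].
  by rewrite big_mkord sumr_const card_ord ltW// truncnS_gt.
by have [cov|//] := boolP (covered x m); case: nex; exists m.
Qed.

(** * Law of the walk and its expected cover time *)

Section Law.
Local Open Scope classical_set_scope.
Context {d : measure_display} {T : measurableType d} {R : realType}.
Variables (P : probability T R) (V : finType).
Variables (rule : (nat -> V) -> nat -> {set V}) (i0 : V) (X : nat -> T -> V).
Hypothesis hX : walk_from P rule i0 X.
Implicit Types (x : nat -> V) (k l m : nat) (j : V).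

Local Notation uncovered m := [set w | ~~ covered (X^~ w) m].

Lemma measurable_uncovered m : measurable (uncovered m).
Proof.
have -> : uncovered m =
    \bigcup_(v in [set: V]) \bigcap_(t in `I_m.+1) ~` (X t @^-1` [set v]).
  apply/seteqP; split => [w /=|w [v _ nv] /=].
    rewrite negb_forall => /existsP[v]; rewrite negb_exists => /forallP nv.
    exists v => // t /= tm xt.
    by have := nv (Ordinal (n:=m.+1) (m:=t) tm); rewrite /= xt eqxx.
  apply/negP => /forallP /(_ v) /existsP[t /eqP xt].
  exact: (nv t (ltn_ord t)).
apply: fin_bigcup_measurable => // v _; apply: bigcap_measurableType => t _.
by apply: measurableC; exact: walk_measurable hX t v.
Qed.

Lemma history_extend x m j : history X (extend x m j) m.+1 =
  X m.+1 @^-1` [set j] `&` history X x m.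
Proof.
apply/seteqP; split => [w /= h|w [/= xj h] t].
  split => [|t tm]; first by rewrite h// /extend ltnn.
  by rewrite h ?(leqW tm)// /extend tm.
rewrite leq_eqVlt /extend => /orP[/eqP ->|]; first by rewrite ltnn.
by rewrite ltnS => tm; rewrite tm h.
Qed.

Lemma measurable_history x m : measurable (history X x m).
Proof.
have -> : history X x m = \bigcap_(t in `I_m.+1) X t @^-1` [set x t].
  by apply/seteqP; split => w h t tm; apply: h.
by apply: bigcap_measurableType => t _; exact: walk_measurable hX t _.
Qed.

Lemma fine_partition m (C : set T) : measurable C ->
  fine (P C) = \sum_j fine (P (X m @^-1` [set j] `&` C)).
Proof.
move=> mC.
have mF j : measurable (X m @^-1` [set j] `&` C).
  by apply: measurableI => //; exact: walk_measurable hX m j.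
have CE : C = \bigcup_(j in [set: V]) (X m @^-1` [set j] `&` C).
  by apply/seteqP; split => [w Cw|w [j _ []]//]; exists (X m w).
rewrite [in LHS]CE measure_fin_bigcup//; [|exact: finite_finset|]; last first.
  by move=> i j _ _ [w [[/= <- _] [/= <- _]]].
rewrite (fsbigE (index_enum V)) ?index_enum_uniq//=; last first.
  by move=> j _; rewrite mem_index_enum.
rewrite (eq_bigl xpredT) => [|j]; last by rewrite in_setT.
rewrite (eq_bigr (fun j => (fine (P (X m @^-1` [set j] `&` C)))%:E)).
  by rewrite sumEFin.
by move=> j _; rewrite fineK// fin_num_measure.
Qed.

Lemma fine_history_extend x m j : fine (P (history X (extend x m j) m.+1)) =
  fine (P (history X x m)) * uniform_on (rule x m) j.
Proof.
rewrite history_extend.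
(* [walk_step] says nothing about a null history; both sides are then 0. *)
have [h0|] := eqVneq (P (history X x m)) 0%E.
  rewrite h0 mul0r -[RHS]/(fine 0%E); congr fine.
  apply: (@subset_measure0 _ _ _ P _ (history X x m)) => //.
  - by rewrite -history_extend; exact: measurable_history.
  - exact: measurable_history.
rewrite -measure_gt0 => h0.
rewrite -(walk_step hX j h0) /cond_prob mulrC divfK//.
rewrite gt_eqF// fine_gt0// h0 ltey_eq fin_num_measure//.
exact: measurable_history.
Qed.

(** Splitting the event by the node at time [m.+1] mirrors the recursion of [uncovered_prob]; [m]
    and [x] vary because the history grows. *)
Lemma fine_uncovered k m x :
  fine (P (history X x m `&` uncovered (m + k)%N)) =
  fine (P (history X x m)) * uncovered_prob R rule k m x.
Proof.
elim: k m x => [|k IH] m x.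
  rewrite addn0 /=.
  have covE w : history X x m w -> covered (X^~ w) m = covered x m.
    by move=> h; apply: eq_covered.
  have [cov|ncov] := boolP (covered x m).
    rewrite mulr0 (_ : _ `&` _ = set0) ?measure0//.
    by apply/seteqP; split => // w [/covE] /= ->; rewrite cov.
  rewrite mulr1; congr (fine (P _)).
  by apply/seteqP; split => [w []//|w h]; split => //=; rewrite covE.
rewrite /= /average mulr_sumr (fine_partition m.+1); last first.
  apply: measurableI; first exact: measurable_history.
  exact: measurable_uncovered.
apply: eq_bigr => j _.
rewrite setIA -history_extend addnS -addSn IH fine_history_extend.
exact/esym/mulrA.
Qed.

Lemma probability_uncovered m :
  P (uncovered m) = (uncovered_prob R rule m 0 (fun=> i0))%:E.
Proof.
have H1 : P (history X (fun=> i0) 0) = 1%E.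
  rewrite -(walk_start hX); congr (P _); apply/seteqP.
  by split => [w h|w h [|//]]; [exact: h|].
have mH := measurable_history (fun=> i0) 0.
(* The walk starts at [i0] only almost surely, so the part of the event outside this history is
   discarded as null. *)
have mU := measurable_uncovered m.
have D0 : P (uncovered m `\` history X (fun=> i0) 0) = 0%E.
  apply: (@subset_measure0 _ _ _ P _ (~` history X (fun=> i0) 0)) => //.
  - exact: measurableD.
  - exact: measurableC.
  - by rewrite [LHS]probability_setC// H1 subee.
rewrite -[LHS]fineK ?fin_num_measure// (measureDI P mU mH).
rewrite [X in (X + _)%E]D0 add0e.
by rewrite setIC -{2}(add0n m) fine_uncovered H1 mul1r.
Qed.

Lemma expected_cover_time_nneseries : expected_cover_time P X =
  (\sum_(0 <= m <oo) (uncovered_prob R rule m 0 (fun=> i0))%:E)%E.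
Proof.
rewrite /expected_cover_time.
under eq_integral do rewrite cover_time_nneseries.
rewrite integral_nneseries//; last first.
  move=> m; apply/measurable_EFinP.
  rewrite (_ : (fun w => _) = \1_(uncovered m)); last first.
    by apply/funext => w; rewrite indicE mem_setE.
  by apply: measurable_indic; exact: measurable_uncovered.
apply: eq_eseriesr => m _; rewrite -probability_uncovered.
rewrite -[X in _ = P X]setIT -integral_indic//; last first.
  exact: measurable_uncovered.
by apply: eq_integral => w _; rewrite indicE mem_setE.
Qed.

(** The limit ignores the first three partial sums; the bound of [negative_feedback_gap] starts at
    [k.+3]. *)
Lemma expected_cover_time_le c :
  (forall k, uncovered_sum R rule k.+3 0 (fun=> i0) <= c) ->
  (expected_cover_time P X <= c%:E)%E.
Proof.
move=> Sc; rewrite expected_cover_time_nneseries.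
apply: lime_le.
  by apply: is_cvg_nneseries => m _ _; rewrite -probability_uncovered.
exists 3%N => // -[|[|[|k]]]//= _.
by rewrite sumEFin lee_fin big_mkord Sc.
Qed.

Lemma expected_cover_time_ge k :
  ((uncovered_sum R rule k 0 (fun=> i0))%:E <= expected_cover_time P X)%E.
Proof.
rewrite expected_cover_time_nneseries /uncovered_sum -sumEFin.
rewrite -(big_mkord xpredT
  (fun l => (uncovered_prob R rule l 0 (fun=> i0))%:E)).
by apply: nneseries_lim_ge => m _ _; rewrite -probability_uncovered.
Qed.

End Law.

(** * Comparison of the two walks *)

Theorem theorem6 (R : realType) (n : nat) (hn : (3 <= n)%N) (i0 : 'I_n)
  (d : measure_display) (T : measurableType d) (P : probability T R)
  (X : nat -> T -> 'I_n)
  (hX : walk_from P (negative_feedback_rule (@complete_graph n)) i0 X)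
  (d' : measure_display) (T' : measurableType d') (P' : probability T' R)
  (Y : nat -> T' -> 'I_n)
  (hY : walk_from P' (random_rule (@complete_graph n)) i0 Y) :
  (expected_cover_time P X < expected_cover_time P' Y)%E.
Proof.
have [c c0 neg_gap] := negative_feedback_gap R hn i0.
have [k rw_gap] := random_gap hn i0 c0.
(* Both walks start with the same potential [h]. Negative feedback keeps a gap of at least [c],
   while after [k] steps the random walk's gap is below [c], so its partial sum already exceeds
   [h - c]. *)
set h := potential R (visited (fun=> i0) 0).
have le_neg : (expected_cover_time P X <= (h - c)%:E)%E.
  apply: (expected_cover_time_le hX) => l.
  by rewrite lerBrDr addrC -lerBrDr; exact: neg_gap.
apply: le_lt_trans le_neg _; apply: lt_le_trans (expected_cover_time_ge hY k).
by rewrite lte_fin ltrBlDr addrC -ltrBlDr; exact: rw_gap.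
Qed.
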